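(* Let $G$ be a finite, simple, connected $3$-$\gamma_{c}$-critical graph with $\kappa(G) + 1 \leq \alpha(G)$. Then $G \in \mathcal{G}_{2}(3,3)$ or $\kappa(G) = \delta(G)$.
   Context: All graphs are finite, simple and connected. A set $D \subseteq V(G)$ is a connected dominating set of $G$ if every vertex of $G$ is in $D$ or adjacent to a vertex of $D$, and $G[D]$ is connected; $\gamma_{c}(G)$ is the minimum size of such a set. For non-adjacent $u,v$, $G+uv$ is $G$ with edge $uv$ added. $G$ is $3$-$\gamma_{c}$-critical if $\gamma_{c}(G)=3$ and $\gamma_{c}(G+uv)<3$ for every pair of non-adjacent vertices $u,v$. $\alpha(G)$ is the independence number, $\delta(G)$ the minimum degree, $\kappa(G)$ the connectivity (minimum size of a vertex set whose removal disconnects $G$). The class $\mathcal{G}_{2}(3,3)$: take integers $j_1, j_2 \geq 3$, pairwise disjoint vertex sets $J_1, J_2$ with $|J_1| = j_1$, $|J_2| = j_2$, two distinct vertices $u_1, u_2 \in J_2$, and three further vertices $w, w_1, v_1$. Form the graph on $J_1 \cup J_2 \cup \{w, w_1, v_1\}$ whose edges are exactly: all edges inside $J_1$ (a clique), all edges inside $J_2$ (a clique), $v_1$ joined to every vertex of $J_1$, $w_1$ joined to every vertex of $J_1 \cup (J_2 \setminus \{u_1\}) \cup \{w\}$, and $w$ joined to every vertex of $J_1 \cup (J_2 \setminus \{u_2\}) \cup \{w_1\}$. $\mathcal{G}_{2}(3,3)$ is the class of all graphs (up to isomorphism) obtained this way. *)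

(* Defs.v *)
From mathcomp Require Import all_boot.

Set Implicit Arguments.
Unset Strict Implicit.
Unset Printing Implicit Defensive.

(* A finite simple graph is a symmetric irreflexive relation on a finType. *)

Section Graph.
Variables (T : finType) (e : rel T).

Definition induced (D : {set T}) : rel T :=
  [rel x y | [&& x \in D, y \in D & e x y]].

(* The empty induced subgraph counts as connected; nonemptiness of the graph
   itself is required separately in [connected_graph]. *)
Definition connected_in (D : {set T}) : bool :=
  [forall x in D, forall y in D, connect (induced D) x y].

Definition connected_graph : bool := (0 < #|T|) && connected_in [set: T].

Definition dominating (D : {set T}) : bool :=
  [forall x, (x \in D) || [exists y in D, e x y]].

Definition connected_dominating (D : {set T}) : bool :=
  dominating D && connected_in D.

(* In a connected graph [set: T] is a connected dominating set, so the default
   #|T| does not affect the minimum. *)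
Definition gamma_c : nat :=
  \big[minn/#|T|]_(D : {set T} | connected_dominating D) #|D|.

Definition add_edge (u v : T) : rel T :=
  [rel x y | [|| e x y, (x == u) && (y == v) | (x == v) && (y == u)]].

Definition independent (S : {set T}) : bool :=
  [forall x in S, forall y in S, ~~ e x y].

Definition alpha : nat := \max_(S : {set T} | independent S) #|S|.

Definition degree (x : T) : nat := #|[set y | e x y]|.

Definition delta : nat := \big[minn/#|T|]_(x : T) degree x.

Definition vertex_cut (S : {set T}) : bool := ~~ connected_in (~: S).

(* A vertex cut leaves at least two vertices, so the default #|T|.-1 is only
   attained when there is no vertex cut, i.e. for complete graphs, where it is
   the usual convention. *)
Definition kappa : nat :=
  \big[minn/#|T|.-1]_(S : {set T} | vertex_cut S) #|S|.

End Graph.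

Definition critical3 (T : finType) (e : rel T) : Prop :=
  gamma_c e = 3 /\
  (forall u v : T, u != v -> ~~ e u v -> gamma_c (add_edge e u v) < 3).

Definition G2_arc (T : finType) (J1 J2 : {set T}) (u1 u2 w w1 v1 : T) : rel T :=
  [rel x y |
    [|| [&& x \in J1, y \in J1 & x != y],
        [&& x \in J2, y \in J2 & x != y],
        (x == v1) && (y \in J1),
        (x == w1) && (y \in J1 :|: (J2 :\ u1) :|: [set w])
      | (x == w) && (y \in J1 :|: (J2 :\ u2) :|: [set w1])]].

(* Membership of (T, e) in G_2(3,3).  The parts are chosen inside T itself and
   exhaust it, so the class is closed under isomorphism. *)
Definition in_G2_33 (T : finType) (e : rel T) : Prop :=
  exists (J1 J2 : {set T}) (u1 u2 w w1 v1 : T),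
    [/\ 3 <= #|J1| /\ 3 <= #|J2|,
        [disjoint J1 & J2] /\ [disjoint J1 :|: J2 & [set w; w1; v1]],
        uniq [:: w; w1; v1] /\ J1 :|: J2 :|: [set w; w1; v1] = [set: T],
        [/\ u1 \in J2, u2 \in J2 & u1 != u2]
      & forall x y : T,
          e x y = G2_arc J1 J2 u1 u2 w w1 v1 x y
                  || G2_arc J1 J2 u1 u2 w w1 v1 y x].

(* Main.v *)
Require Import Defs.
From mathcomp Require Import all_boot.

Set Implicit Arguments.
Unset Strict Implicit.
Unset Printing Implicit Defensive.

(* Assume kappa < delta, and let S be a minimum cut and I an independent set with
   |I| > |S|.  Every component of G - S has at least two vertices.  By
   criticality, two vertices x, v of I are related, in one direction, by some
   [x, y] -> v: x ~ y and {x, y} dominates everything except v; then y is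
   adjacent to all of I except v.  If x lies outside S, then y lies in S, since
   {x, y} must reach another component.  So, inside I \ S, the witnesses of
   distinct heads are distinct elements of S \ I; counting gives |I| = |S| + 1
   and a source x0 of I \ S whose out-arrows have witnesses exhausting S \ I,
   while every z in I /\ S points to x0 with a witness outside S.  Applying
   criticality to pairs (a, b) separated by S, with a in the component A of x0,
   excludes everything except |I /\ S| = |S \ I| = 1, where the adjacencies are
   forced to be those of G_2(3,3). *)

(** * Minima over a finite family with a default value *)

Section BigMin.
Variables (I : finType) (P : pred I) (F : I -> nat) (d : nat).

Lemma bigminn_le_default : \big[minn/d]_(i | P i) F i <= d.
Proof. by elim/big_rec: _ => // i m _ le_md; rewrite geq_min le_md orbT. Qed.

Lemma bigminn_le i : P i -> \big[minn/d]_(j | P j) F j <= F i.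
Proof.
move=> Pi; rewrite -big_filter.
have: i \in [seq j <- index_enum I | P j] by rewrite mem_filter Pi mem_index_enum.
elim: [seq _ <- _ | _] => // j s IHs; rewrite inE big_cons geq_min.
by case/predU1P=> [<-|/IHs->]; rewrite ?leqnn ?orbT.
Qed.

Lemma bigminn_witness :
  \big[minn/d]_(i | P i) F i = d \/
  exists2 i, P i & \big[minn/d]_(j | P j) F j = F i.
Proof.
elim/big_rec: _ => [|i m Pi IHm]; first by left.
case: (leqP (F i) m) => _; first by right; exists i.
by case: IHm => [->|[j Pj ->]]; [left | right; exists j].
Qed.

End BigMin.

(** * Dominating pairs and arrows *)

Section Graph.
Variables (T : finType) (e : rel T).
Hypotheses (e_sym : symmetric e) (e_irr : irreflexive e).

(** [x = y] is allowed, so single vertices and edges are treated alike. *)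
Definition dominates2 (x y w : T) : bool :=
  [|| w == x, w == y, e x w | e y w].

(* The relation written [x, y] -> v in the literature. *)
Definition arrow (x y v : T) : bool :=
  [&& e x y, x != v, ~~ e x v, ~~ e y v
    & [forall w, (w != v) ==> dominates2 x y w]].

Lemma arrowP x y v :
  reflect [/\ e x y, x != v, e x v = false, e y v = false
            & forall w, w != v -> dominates2 x y w]
          (arrow x y v).
Proof.
apply: (iffP and5P) => [[exy nxv /negPf nexv /negPf neyv /forallP D]|].
  by split=> // w nwv; apply: (implyP (D w)).
by case=> exy nxv -> -> D; split=> //; apply/forallP=> w; apply/implyP/D.
Qed.

Lemma arrow_edge x y v : arrow x y v -> e x y.
Proof. by case/arrowP. Qed.

Lemma arrow_missr x y v : arrow x y v -> e y v = false.
Proof. by case/arrowP. Qed.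

Lemma arrow_dominates x y v w :
  arrow x y v -> w != v -> w != x -> w != y -> e x w = false -> e y w.
Proof.
case/arrowP=> _ _ _ _ D /D; rewrite /dominates2.
by move=> /or4P[->|->| ->|].
Qed.

Lemma connected_pair x y :
  x = y \/ e x y -> connected_in e [set x; y].
Proof.
have step u v : u \in [set x; y] -> v \in [set x; y] -> u = v \/ e u v ->
    connect (induced e [set x; y]) u v.
  move=> u_in v_in [->|euv]; first exact: connect0.
  by apply: connect1; apply/and3P.
move=> exy; apply/forallP=> u; apply/implyP=> u_in.
apply/forallP=> v; apply/implyP=> v_in; apply: step => //.
move: u_in v_in; rewrite !inE.
case: exy => [<-|exy]; first by rewrite !orbb => /eqP-> /eqP->; left.
by case/orP=> /eqP-> /orP[]/eqP->; [left|right|rewrite e_sym; right|left].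
Qed.

Lemma connected_in_pair_edge x y :
  x != y -> connected_in e [set x; y] -> e x y.
Proof.
move=> nxy /forallP/(_ x)/implyP; rewrite !inE eqxx => /(_ isT).
move=> /forallP/(_ y)/implyP; rewrite !inE eqxx orbT => /(_ isT).
case/connectP=> [[|z p] /= pth lst]; first by rewrite lst eqxx in nxy.
case/andP: pth => /and3P[_]; rewrite !inE.
by case/orP=> /eqP-> //; rewrite e_irr.
Qed.

Lemma gamma_c_gt2 x y :
  2 < gamma_c e -> x = y \/ e x y -> ~ (forall w, dominates2 x y w).
Proof.
move=> g3 exy D; have CD : connected_dominating e [set x; y].
  rewrite /connected_dominating connected_pair // andbT.
  apply/forallP=> w; have /or4P[wx|wy|xw|yw] := D w; rewrite !inE.
  - by rewrite wx.
  - by rewrite wy orbT.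
  - apply/orP; right; apply/existsP; exists x.
    by rewrite !inE eqxx e_sym.
  - apply/orP; right; apply/existsP; exists y.
    by rewrite !inE eqxx orbT e_sym.
have := leq_trans g3 (bigminn_le (fun D : {set T} => #|D|) #|T| CD).
by rewrite cards2; case: (_ != _).
Qed.

End Graph.

(** * What criticality says about a non-adjacent pair *)

Section Critical.
Variables (T : finType) (e : rel T).
Hypotheses (e_sym : symmetric e) (e_irr : irreflexive e).
Hypotheses (e_conn : connected_graph e) (e_crit : critical3 e).

Local Notation dom2 := (dominates2 e).
Local Notation arrow := (arrow e).

Lemma not_CDS x y : x = y \/ e x y -> ~ (forall w, dom2 x y w).
Proof. by apply: gamma_c_gt2 => //; rewrite (proj1 e_crit). Qed.

Lemma closed_full (A : {set T}) a :
  a \in A -> (forall x y, x \in A -> e x y -> y \in A) -> forall b, b \in A.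
Proof.
move=> aA clA b; have [_ /forallP/(_ a)/implyP] := andP e_conn.
rewrite inE => /(_ isT)/forallP/(_ b)/implyP; rewrite inE => /(_ isT).
case/connectP=> p; elim: p a aA => [|c p IHp] a aA /=; first by move=> _ ->.
by case/andP=> /and3P[_ _ /(clA _ _ aA) cA] /IHp; apply.
Qed.

Lemma exists_neighbour x y : x != y -> exists z, e x z.
Proof.
move=> nxy; case: (pickP (e x)) => [z xz|no]; first by exists z.
have := @closed_full [set x] x; rewrite inE eqxx => /(_ isT) full.
have: y \in [set x].
  by apply: full => u v; rewrite inE => /eqP->; rewrite no.
by rewrite inE eq_sym (negPf nxy).
Qed.

(** Some connected dominating set of G + uv has at most two vertices, and it fails in G. Either the
    new edge joins its two vertices, which gives the first alternative, or it is an edge of G that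
    contains one of [u], [v] and misses only the other, which gives an arrow. *)
Lemma critical_nonadjacent u v :
  u != v -> e u v = false ->
  [\/ forall w, dom2 u v w,
      exists y, arrow u y v
    | exists y, arrow v y u].
Proof.
have half x y a b : e x y -> x = a -> a != b -> e a b = false ->
    (forall w, w != b -> dom2 x y w) -> arrow a y b.
  move=> exy <- nab neab D; apply/arrowP; split=> //.
  case eyb: (e y b) => //; case: (not_CDS (or_intror exy)) => w.
  case: (eqVneq w b) => [->|/D //]; by rewrite /dominates2 eyb !orbT.
have dom2C x y w : dom2 x y w = dom2 y x w.
  by rewrite /dominates2 orbCA; do 2!congr (_ || _); rewrite orbC.
move=> nuv neuv; set e' := add_edge e u v.
have e'_irr : irreflexive e'.
  move=> x; rewrite /e' /add_edge /= e_irr /= (andbC (x == v)) orbb.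
  by apply: contraNF nuv => /andP[/eqP<- ->].
(* Having three vertices keeps the default [#|T|] from being the value of [gamma_c e']. *)
have [T3 g3] : 3 <= #|T| /\ gamma_c e' < 3.
  split; last by apply: (proj2 e_crit) => //; rewrite neuv.
  by rewrite -(proj1 e_crit) bigminn_le_default.
have [D /andP[domD conD] cD] : exists2 D, connected_dominating e' D & #|D| < 3.
  have [E|[D CD E]] := bigminn_witness (connected_dominating e') (fun D => #|D|) #|T|.
    by move: g3; rewrite /gamma_c E ltnNge T3.
  by exists D; rewrite // -E.
have [x [y [Exy Dxy]]] : exists x y,
    (x = y \/ e' x y) /\ forall w, [|| w == x, w == y, e' w x | e' w y].
  have [x xD] : exists x, x \in D.
    have /forallP/(_ u)/orP[uD|/existsP[y /andP[yD _]]] := domD; last by exists y.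
    by exists u.
  have [y yD Dxy] : exists2 y, y \in D & D = [set x; y].
    move: cD; rewrite (cardsD1 x) xD ltnS => cD.
    have [D0|[y yDx]] := set_0Vmem (D :\ x).
      exists x => //; apply/setP=> w; rewrite !inE orbb.
      by move/setP/(_ w): D0; rewrite !inE; case: eqP => [->|].
    have D1: D :\ x = [set y] by apply/esym/eqP; rewrite eqEcard sub1set yDx cards1.
    exists y; first by case/setD1P: yDx.
    by rewrite -(setD1K xD) D1.
  exists x, y; split.
    case: (eqVneq x y) => [|nxy]; [by left | right].
    by apply: (connected_in_pair_edge e'_irr) => //; rewrite -Dxy.
  move=> w; have /forallP/(_ w) := domD; rewrite Dxy !inE -orbA.
  case/or3P=> [->|->|/existsP[z]]; rewrite ?orbT //.
  by rewrite !inE => /andP[/orP[]/eqP-> ->]; rewrite ?orbT.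
move=> {D domD conD cD T3 g3}.
have e'E w z : e' w z -> [\/ e z w, w = u /\ z = v | w = v /\ z = u].
  by rewrite /e' /add_edge /= e_sym => /or3P[?|/andP[/eqP-> /eqP->]|/andP[/eqP-> /eqP->]];
    [constructor 1|constructor 2|constructor 3].
have dom w : dom2 x y w \/ (w = u /\ (x = v \/ y = v)) \/ (w = v /\ (x = u \/ y = u)).
  rewrite /dominates2.
  have /or4P[->|->|/e'E|/e'E] := Dxy w; rewrite ?orbT; [by left|by left| |];
    by case=> [->|[-> ->]|[-> ->]]; rewrite ?orbT; auto.
have {e'E} : [\/ x = y, e x y, x = u /\ y = v | x = v /\ y = u].
  case: Exy => [->|/e'E[]]; first by constructor 1.
  - by rewrite e_sym; constructor 2.
  - by constructor 3.
  - by constructor 4.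
case=> [xy|exy|[xu yv]|[xv yu]].
- move: dom; rewrite -{}xy => dom.
  (* A single vertex dominating all but [b] would form, with a neighbour of [b], a connected
     dominating pair of G. *)
  have key a b : a != b -> e a b = false -> x = a ->
      (forall w, w != b -> dom2 x x w) -> False.
    move=> nab neab xa D; have [z bz] : exists z, e b z.
      by apply: (@exists_neighbour b a); rewrite eq_sym.
    have nzb : z != b by apply: contraTneq bz => ->; rewrite e_irr.
    have xz : z = x \/ e x z by case/or4P: (D z nzb) => [/eqP|/eqP| |]; auto.
    case: xz => [zx|xz]; first by rewrite zx xa e_sym neab in bz.
    apply: (not_CDS (or_intror xz)) => w; rewrite /dominates2.
    case: (eqVneq w b) => [->|/D]; first by rewrite (e_sym z) bz !orbT.
    by case/or4P=> ->; rewrite ?orbT.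
  case: (eqVneq x u) => [xu|nxu].
    case: (@key u v) => // w nwv; case: (dom w) => [//|[[->]|[wv]]].
      by rewrite xu; case=> vu; rewrite vu eqxx in nuv.
    by rewrite wv eqxx in nwv.
  case: (eqVneq x v) => [xv|nxv].
    case: (@key v u) => //; rewrite 1?eq_sym 1?e_sym // => w nwu.
    case: (dom w) => [//|[[wu]|[wv]]].
      by rewrite wu eqxx in nwu.
    by rewrite xv; case=> vu; rewrite -vu eqxx in nuv.
  case: (@not_CDS x x); first by left.
  move=> w; case: (dom w) => [//|[[_ []]|[_ []]]] /eqP; rewrite ?(negPf nxu) ?(negPf nxv) //.
- have ndom : ~ forall w, dom2 x y w by apply: not_CDS; right.
  have nvu : v != u by rewrite eq_sym.
  have nevu : e v u = false by rewrite e_sym.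
  have domD' w : w != u -> w != v -> dom2 x y w.
    by move=> nwu nwv; case: (dom w) => [//|[[/eqP]|[/eqP]]]; rewrite ?(negPf nwu) ?(negPf nwv).
  (* The endpoint that the edge xy misses in G is dominated through the new edge, so the other
     endpoint is [x] or [y]. *)
  case: (boolP (dom2 x y u)) => [du|ndu].
    have D w : w != v -> dom2 x y w by case: (eqVneq w u) => [->|]; auto.
    case: (dom v) => [dv|[[/eqP]|[_ [xu|yu]]]].
    + by case: ndom => w; case: (eqVneq w v) => [->|/D].
    + by rewrite (negPf nvu).
    + by constructor 2; exists y; apply: half xu _ _ D.
    + constructor 2; exists x; apply: (half y x) => //; first by rewrite e_sym.
      by move=> w /D; rewrite dom2C.
  have du : x = v \/ y = v.
    by case: (dom u) => [du|[[_ //]|[/eqP]]]; [rewrite du in ndu | rewrite (negPf nuv)].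
  have D w : w != u -> dom2 x y w.
    move=> nwu; case: (eqVneq w v) => [->|]; last exact: domD'.
    by rewrite /dominates2; case: du => ->; rewrite eqxx ?orbT.
  case: du => [xv|yv].
    by constructor 3; exists y; apply: half xv _ _ D.
  constructor 3; exists x; apply: (half y x) => //; first by rewrite e_sym.
  by move=> w /D; rewrite dom2C.
- constructor 1 => w; rewrite -xu -yv; case: (dom w) => [//|[[-> _]|[-> _]]];
  by rewrite /dominates2 ?xu ?yv eqxx ?orbT.
- constructor 1 => w; rewrite dom2C -xv -yu; case: (dom w) => [//|[[-> _]|[-> _]]];
  by rewrite /dominates2 ?xv ?yu eqxx ?orbT.
Qed.


(** * A cut smaller than every degree *)

Section Cut.
Variable S : {set T}.
Hypotheses (S_cut : vertex_cut e S) (S_degree : forall x, #|S| < degree e x).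

(** A union of components of G - S that contains [x] and leaves out some vertex [b] of G - S. *)
Definition side (A : {set T}) (x : T) : Prop :=
  [/\ x \in A, forall a, a \in A -> a \notin S,
      forall a v, a \in A -> e a v -> v \notin S -> v \in A
    & exists2 b, b \notin A & b \notin S].

(** The component of [x] in G - S serves; it is not all of G - S because [S] is a cut. *)
Lemma side_exists x : x \notin S -> exists A, side A x.
Proof.
move=> xS; set r := induced e (~: S).
have r_sym : connect_sym r.
  by apply: sym_connect_sym => u v; rewrite /r /induced /= e_sym andbCA.
exists [set v | connect r x v]; split.
- by rewrite inE connect0.
- move=> a; rewrite inE => /connectP[p]; case/lastP: p => [|p v] /=.
    by move=> _ ->.
  by rewrite rcons_path last_rcons => /andP[_ /and3P[_]] + _ ->; rewrite inE.
- move=> a v; rewrite !inE => xa av vS; apply: connect_trans (xa) (connect1 _).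
  rewrite /r /induced /= !inE vS av !andbT.
  case/connectP: xa => p; case/lastP: p => [|p w] /=; first by move=> _ ->.
  by rewrite rcons_path last_rcons => /andP[_ /and3P[_]] + _ ->; rewrite inE.
- case: (pickP [pred b | ~~ connect r x b && (b \notin S)]) => [b|full].
    by case/andP=> xb bS; exists b; rewrite ?inE.
  have xr b : b \notin S -> connect r x b.
    by move=> bS; have:= full b; rewrite /= bS andbT => /negbFE.
  case/negP: S_cut; apply/forallP=> u; apply/implyP; rewrite inE => uS.
  apply/forallP=> v; apply/implyP; rewrite inE => vS.
  by apply: connect_trans (xr v vS); rewrite r_sym; apply: xr.
Qed.

Lemma neighbour_outside x : exists2 y, e x y & y \notin S.
Proof.
case: (pickP [pred y | e x y & y \notin S]) => [y /andP[]|no]; first by exists y.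
have := S_degree x; rewrite ltnNge => /negP[]; apply/subset_leq_card.
by apply/subsetP=> y; rewrite inE => xy; have := no y; rewrite /= xy => /negbFE.
Qed.

Section Side.
Variables (A : {set T}) (x0 : T).
Hypothesis A_side : side A x0.

Lemma side_far a b : a \in A -> b \notin A -> b \notin S -> e a b = false.
Proof.
case: A_side => _ _ clA _ aA bA bS; apply: contraNF bA => ab; exact: clA ab bS.
Qed.

Lemma side_farC a b : a \in A -> b \notin A -> b \notin S -> e b a = false.
Proof. by rewrite e_sym; apply: side_far. Qed.

Lemma side_neighbour a : a \in A -> exists2 a', e a a' & a' \in A.
Proof.
move=> aA; have [a' aa' a'S] := neighbour_outside a; exists a' => //.
by case: A_side => _ _ /(_ _ _ aA aa' a'S).
Qed.

Lemma opposite_neighbour b : b \notin A -> b \notin S ->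
  exists b', [/\ e b b', b' \notin A & b' \notin S].
Proof.
move=> bA bS; have [b' bb' b'S] := neighbour_outside b; exists b'; split=> //.
by apply: contraTN bb' => b'A; rewrite side_farC.
Qed.

Lemma memA_neq a b : a \in A -> b \notin A -> a != b.
Proof. by move=> aA; apply: contraNneq => <-. Qed.

End Side.

(** If [y] were outside [S], both [x] and [y] would lie in one side and could not dominate the rest
    of G - S. That rest would be [v] alone, yet it contains an edge. *)
Lemma arrow_in_cut x y v : x \notin S -> arrow x y v -> y \in S.
Proof.
move=> xS xyv; apply/negPn/negP=> yS; have [A sA] := side_exists xS.
have [xA AS clA [b bA bS]] := sA.
have yA : y \in A := clA _ _ xA (arrow_edge xyv) yS.
have onlyv w : w \notin A -> w \notin S -> w = v.
  move=> wA wS; apply: contraTeq (xyv) => nwv; apply/negP=> _.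
  have := arrow_dominates xyv nwv.
  rewrite !(eq_sym w) !(memA_neq _ wA) // !(side_far sA) //.
  by move=> /(_ isT isT erefl).
have [b' [bb' b'A b'S]] := opposite_neighbour sA bA bS.
by rewrite (onlyv b) // (onlyv b') // e_irr in bb'.
Qed.

(** If [S] were a single vertex [c], all arrow witnesses between the sides would be [c]. Then [c]
    and a neighbour of [c] in [A] form a dominating edge, or [A] has no neighbour of [c] and G is
    disconnected. *)
Lemma cut_gt1 : 1 < #|S|.
Proof.
rewrite ltnNge; apply/negP=> S1.
have [c cS] : exists c, c \in S.
  case: (set_0Vmem S) => [S0|[c]]; last by exists c.
  case/negP: S_cut; rewrite S0 setC0; by case/andP: e_conn.
have {S1} SE : S = [set c].
  by apply/esym/eqP; rewrite eqEcard sub1set cS cards1.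
have [a0 na0c nea0c] : exists2 a, a != c & e a c = false.
  case: (pickP [pred a | (a != c) && ~~ e a c]) => [a /andP[? /negPf]|all].
    by exists a.
  case: (@not_CDS c c); first by left.
  move=> w; rewrite /dominates2; case: (eqVneq w c) => //= nwc.
  by have := all w; rewrite /= nwc e_sym => /negbFE->.
have inS w : (w \in S) = (w == c) by rewrite SE inE.
have a0S : a0 \notin S by rewrite inS.
have [A sA] := side_exists a0S; have [a0A AS clA [b bA bS]] := sA.
have nSc w : w \notin S -> w != c by rewrite inS.
(* Compare [b'] with [a0], which is not adjacent to [c]: domination of [c], or the arrow with
   witness [c], must come from [b']. *)
have cB b' : b' \notin A -> b' \notin S -> e c b'.
  move=> b'A b'S; have nab := memA_neq a0A b'A.
  have [D|[y ayb]|[y bya]] := critical_nonadjacent nab (side_far sA a0A b'A b'S).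
  - have := D c; rewrite /dominates2 nea0c !(eq_sym c) (negPf na0c) (negPf (nSc _ b'S)) /=.
    by rewrite e_sym.
  - have := arrow_in_cut a0S ayb; rewrite inS => /eqP yc.
    by rewrite -yc (arrow_edge ayb) in nea0c.
  - have := arrow_in_cut b'S bya; rewrite inS => /eqP yc.
    by rewrite e_sym -yc (arrow_edge bya).
have cA a a' : a \in A -> e a c = false -> a' \in A -> a' != a -> e a a'.
  move=> aA neac a'A na'a.
  have [D|[y ayb]|[y bya]] :=
    critical_nonadjacent (memA_neq aA bA) (side_far sA aA bA bS).
  - have := D a'; rewrite /dominates2 (negPf na'a) (negPf (memA_neq a'A bA)).
    by rewrite (side_farC sA a'A bA bS) /= orbF.
  - have := arrow_in_cut (AS _ aA) ayb; rewrite inS => /eqP yc.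
    by rewrite -yc (arrow_edge ayb) in neac.
  (* Here [c] is adjacent to all of [A] except [a], so [c] and a neighbour [a1] of [a] dominate
     G. *)
  - have := arrow_in_cut bS bya; rewrite inS => /eqP yc; rewrite {y}yc in bya.
    have cA w : w \in A -> w != a -> e c w.
      move=> wA nwa; apply: (arrow_dominates bya) => //.
      + exact: memA_neq wA bA.
      + by rewrite nSc ?AS.
      + exact: (side_farC sA).
    have [a1 aa1 a1A] := side_neighbour sA aA.
    have na1a : a1 != a by apply: contraTneq aa1 => ->; rewrite e_irr.
    case: (@not_CDS c a1); first by right; apply: cA.
    move=> w; rewrite /dominates2; case: (eqVneq w c) => //= nwc.
    case: (boolP (w \in A)) => wA; last by rewrite cB ?orbT // inS.
    case: (eqVneq w a) => [->|nwa]; last by rewrite cA ?orbT.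
    by rewrite (e_sym a1) aa1 !orbT.
case: (pickP [pred a in A | e a c]) => [a /andP[aA ac]|no].
  case: (@not_CDS c a); first by right; rewrite e_sym.
  move=> w; rewrite /dominates2; case: (eqVneq w c) => //= nwc.
  case: (boolP (w \in A)) => wA; last by rewrite cB ?orbT // inS.
  case: (eqVneq w a) => //= nwa; case wc: (e w c); first by rewrite e_sym wc.
  by rewrite (e_sym a) (cA w) ?orbT // eq_sym.
case/negP: bA; apply: (closed_full a0A) => u v uA uv.
apply: (clA _ _ uA (uv)); rewrite inS; apply: contraTneq uv => ->.
by have := no u; rewrite /= uA /= => ->.
Qed.

(** * Arrows inside an independent set larger than the cut *)

Section Independent.
Variable I : {set T}.
Hypotheses (I_indep : {in I &, forall x y, e x y = false}) (I_gt : #|S| < #|I|).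

Lemma arrow_indep x y v : x \in I -> v \in I -> arrow x y v ->
  y \notin I /\ forall u, u \in I -> u != v -> e y u.
Proof.
move=> xI vI xyv; have xy := arrow_edge xyv.
have yI : y \notin I by apply: contraTN xy => yI; rewrite I_indep.
split=> // u uI nuv; case: (eqVneq u x) => [->|nux]; first by rewrite e_sym.
apply: (arrow_dominates xyv) => //; last exact: I_indep.
by apply: contraNneq yI => <-.
Qed.

(** The pair itself cannot dominate: [I] has a third vertex, since its size exceeds that of [S],
    which is at least 2. *)
Lemma arrow_total x v : x \in I -> v \in I -> x != v ->
  exists y, arrow x y v || arrow v y x.
Proof.
move=> xI vI nxv.
have [D|[y a]|[y a]] := critical_nonadjacent nxv (I_indep xI vI);
  [|by exists y; rewrite a|by exists y; rewrite a orbT].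
have: 0 < #|I :\ x :\ v|.
  have := leq_ltn_trans cut_gt1 I_gt.
  by rewrite (cardsD1 x) xI (cardsD1 v (I :\ x)) !inE eq_sym nxv vI.
case/card_gt0P=> u; rewrite !inE => /and3P[nuv nux uI].
by have := D u; rewrite /dominates2 (negPf nuv) (negPf nux) !I_indep.
Qed.

Lemma arrow_from_outside x y v :
  x \in I :\: S -> v \in I -> arrow x y v -> y \in S :\: I.
Proof.
case/setDP=> xI xS vI xyv; rewrite inE (arrow_in_cut xS xyv) andbT.
by case: (arrow_indep xI vI xyv).
Qed.

Lemma card_outside : #|S :\: I| < #|I :\: S|.
Proof. by move: I_gt; rewrite -(cardsID S I) -(cardsID I S) setIC ltn_add2l. Qed.

(* Distinct heads have distinct witnesses in S \ I, which is smaller than I \ S,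
   so some x0 in I \ S is not a head. *)
Lemma source_exists : exists x0 (g : T -> T),
  [/\ x0 \in I :\: S,
      {in I :\: S :\ x0 &, injective g},
      g @: (I :\: S :\ x0) = S :\: I
    & forall v, v \in I :\: S :\ x0 -> arrow x0 (g v) v].
Proof.
(* A witness determines its head, the only vertex of [I] that it is not adjacent to. *)
have wit_inj (H : {set T}) (f : T -> T) (t : T -> T) : H \subset I :\: S ->
    (forall v, v \in H -> t v \in I :\: S /\ arrow (t v) (f v) v) ->
    {in H &, injective f} /\ f @: H \subset S :\: I.
  move=> /subsetP sH Hf; split.
    move=> v v' vH v'H ff; apply/eqP/negPn/negP=> nvv'.
    have [/setDP[tI _] a] := Hf v vH; have [/setDP[t'I _] a'] := Hf v' v'H.
    have [/setDP[vI _] /setDP[v'I _]] := (sH _ vH, sH _ v'H).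
    have [_ /(_ v vI nvv')] := arrow_indep t'I v'I a'.
    by rewrite -ff (arrow_missr a).
  apply/subsetP=> _ /imsetP[v vH ->]; have [tIS a] := Hf v vH.
  by have /setDP[vI _] := sH v vH; apply: arrow_from_outside a.
(* The pair [p] holds a tail in [I :\: S] and a witness of an arrow to [v]; [H] is the set of
   heads. *)
pose hitby v := [pred p : T * T | (p.1 \in I :\: S) && arrow p.1 p.2 v].
pose h v := odflt (v, v) [pick p | hitby v p].
pose H := [set v in I :\: S | [exists p, hitby v p]].
have hH v : v \in H -> (h v).1 \in I :\: S /\ arrow (h v).1 (h v).2 v.
  rewrite inE => /andP[_ /existsP[p pv]]; rewrite /h.
  by case: pickP => [q /andP[]|/(_ p)] //; rewrite pv.
have HIS : H \subset I :\: S by apply/subsetP=> v; rewrite inE => /andP[].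
have [inj_f im_f] := wit_inj H (fun v => (h v).2) (fun v => (h v).1) HIS hH.
have: ~~ (I :\: S \subset H).
  apply: contraL card_outside => /subset_leq_card le; rewrite -leqNgt.
  by apply: leq_trans le _; rewrite -(card_in_imset inj_f) subset_leq_card.
case/subsetPn=> x0 x0IS x0H.
pose g v := odflt v [pick y | arrow x0 y v].
have gP v : v \in I :\: S :\ x0 -> arrow x0 (g v) v.
  case/setD1P=> nvx0 vIS; have [/setDP[x0I _] /setDP[vI _]] := (x0IS, vIS).
  have [y /orP[a|a]] := arrow_total x0I vI (contra_neq esym nvx0).
    by rewrite /g; case: pickP => [//|/(_ y)]; rewrite a.
  case/negP: x0H; rewrite inE x0IS; apply/existsP; exists (v, y).
  by rewrite /= vIS.
have [inj_g im_g] := wit_inj _ g (fun=> x0) (subsetDl _ _)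
  (fun v vH => conj x0IS (gP v vH)).
(* [g] is onto because [S :\: I] has at most as many elements as [I :\: S :\ x0]. *)
exists x0, g; split=> //; apply/eqP; rewrite eqEcard im_g card_in_imset //.
by have := card_outside; rewrite (cardsD1 x0 (I :\: S)) x0IS.
Qed.


(** * The source [x0] and the two sides of the cut *)

Section Source.
Variables (x0 : T) (g : T -> T) (A : {set T}).
Hypotheses (x0_in : x0 \in I :\: S) (g_inj : {in I :\: S :\ x0 &, injective g}).
Hypothesis g_im : g @: (I :\: S :\ x0) = S :\: I.
Hypothesis g_arrow : forall v, v \in I :\: S :\ x0 -> arrow x0 (g v) v.
Hypothesis A_side : side A x0.

Let x0I : x0 \in I. Proof. by case/setDP: x0_in. Qed.
Let x0S : x0 \notin S. Proof. by case/setDP: x0_in. Qed.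
Let x0A : x0 \in A. Proof. by case: A_side. Qed.
Let AS a : a \in A -> a \notin S. Proof. by case: A_side => _ /(_ a). Qed.

Lemma source_arrow y : y \in S :\: I ->
  exists v, [/\ v \in I, v \notin S, v != x0 & arrow x0 y v].
Proof.
rewrite -g_im => /imsetP[v vX ->]; exists v; rewrite g_arrow //.
by case/setD1P: vX => nv /setDP[].
Qed.

Lemma cut_adj_source y : y \in S :\: I -> e y x0.
Proof. by case/source_arrow=> v [_ _ _ /arrow_edge]; rewrite e_sym. Qed.

Lemma cut_adj_indep y z : y \in S :\: I -> z \in I -> z \in S -> e y z.
Proof.
case/source_arrow=> v [vI vS _ a] zI zS; have [_ ->] := arrow_indep x0I vI a => //.
by apply: contraNneq vS => <-.
Qed.

(** A witness in [S] would lie in [S :\: I], hence be adjacent to every vertex of [I] in [S],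
    including the head. *)
Lemma arrow_inside_cut z w z' : z \in I -> z' \in I -> z' \in S ->
  arrow z w z' -> w \notin S.
Proof.
move=> zI z'I z'S a; have [wI _] := arrow_indep zI z'I a.
apply/negP=> wS; have := arrow_missr a; rewrite cut_adj_indep //.
by rewrite inE wI.
Qed.

(** The reverse arrow would have its witness in [S :\: I], where every vertex is adjacent to [z].
    Those vertices are also adjacent to [x0], so the witness found is outside [S]. *)
Lemma arrow_to_source z : z \in I -> z \in S -> exists2 w, w \notin S & arrow z w x0.
Proof.
move=> zI zS; have nzx0 : z != x0 by apply: contraNneq x0S => <-.
have [w /orP[a|a]] := arrow_total zI x0I nzx0.
  exists w => //; have [wI _] := arrow_indep zI x0I a.
  apply/negP=> wS; have := arrow_missr a; rewrite cut_adj_source //.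
  by rewrite inE wI.
have /setDP[wS _] := arrow_from_outside x0_in zI a.
by have := arrow_inside_cut x0I zI zS a; rewrite wS.
Qed.

Lemma cut_dominates_opposite y v b : y \in S :\: I -> arrow x0 y v ->
  b \notin A -> b \notin S -> b != v -> e y b.
Proof.
case/setDP=> yS _ a bA bS nbv; apply: (arrow_dominates a) => //.
- by apply: contraNneq bA => ->.
- by apply: contraNneq bS => ->.
- exact: (side_far A_side).
Qed.

Lemma cut_adj_opposite y b : y \in S :\: I ->
  b \notin A -> b \notin S -> b \notin I -> e y b.
Proof.
move=> yY bA bS bI; have [v [vI _ _ a]] := source_arrow yY.
by apply: (cut_dominates_opposite yY a) => //; apply: contraNneq bI => ->.
Qed.

(** Otherwise every vertex of [S] is adjacent to [x0] and to each opposite vertex [b] outside [I].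
    No arrow then joins [x0] and [b], so they dominate G, and the rest of [I] lies opposite. For the
    witness [y] of an arrow from a vertex of [I] other than [x0], the edge yb dominates G. *)
Lemma source_cut_meets_indep : exists2 z, z \in I & z \in S.
Proof.
case: (pickP [pred z in I | z \in S]) => [z /andP[]|no]; first by exists z.
have IS v : v \in I -> v \notin S by move=> vI; have := no v; rewrite /= vI => /= ->.
have SI y : y \in S -> y \in S :\: I.
  by move=> yS; rewrite inE yS andbT; apply: contraL yS; apply: IS.
have [b [bA bS bI]] : exists b, [/\ b \notin A, b \notin S & b \notin I].
  have [_ _ _ [b bA bS]] := A_side; case: (boolP (b \in I)) => bI; last by exists b.
  have [b' [bb' b'A b'S]] := opposite_neighbour A_side bA bS; exists b'; split=> //.
  by apply: contraTN bb' => b'I; rewrite I_indep.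
have D : forall w, dom2 x0 b w.
  have [//|[y a]|[y a]] :=
    critical_nonadjacent (memA_neq x0A bA) (side_far A_side x0A bA bS).
    have yS := arrow_in_cut x0S a.
    by have := arrow_missr a; rewrite (cut_adj_opposite (SI _ yS)).
  have yS := arrow_in_cut bS a.
  by have := arrow_missr a; rewrite (cut_adj_source (SI _ yS)).
have bX v : v \in I -> v != x0 -> v \notin A /\ e b v.
  move=> vI nv; have := D v; rewrite /dominates2 (negPf nv) I_indep //=.
  case/predU1P=> [vb|bv]; first by rewrite -vb vI in bI.
  by split=> //; apply: contraTN bv => vA; rewrite (side_farC A_side).
have: 1 < #|I :\ x0|.
  by have := leq_ltn_trans cut_gt1 I_gt; rewrite (cardsD1 x0) x0I.
case/card_gt1P=> u [v []]; rewrite !inE => /andP[nu uI] /andP[nv vI] nuv.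
have {u v nu uI nv vI nuv} [u [y [v [uI nu vI a]]]] :
    exists u y v, [/\ u \in I, u != x0, v \in I & arrow u y v].
  by have [y /orP[a|a]] := arrow_total uI vI nuv; [exists u, y, v | exists v, y, u].
have yS := arrow_in_cut (IS _ uI) a; have yY := SI _ yS.
case: (@not_CDS y b); first by right; apply: cut_adj_opposite.
move=> w; rewrite /dominates2; case: (boolP (w \in S)) => [wS|wS].
  by rewrite (e_sym b) (cut_adj_opposite (SI w wS)) ?orbT.
case: (boolP (w \in A)) => wA; last first.
  have := D w; rewrite /dominates2 (side_far A_side x0A wA wS) /=.
  rewrite eq_sym (negPf (memA_neq x0A wA)) /=.
  by case/orP=> ->; rewrite !orbT.
have [uA _] := bX u uI nu.
have ew: v == w \/ e y w.
  case: (eqVneq v w) => nvw; [by left | right].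
  apply: (arrow_dominates a); first by rewrite eq_sym.
  - exact: memA_neq wA uA.
  - by apply: contraNneq (AS wA) => ->.
  - exact: (side_farC A_side wA uA (IS _ uI)).
case: ew => [/eqP vw|->]; last by rewrite !orbT.
case: (eqVneq v x0) => [vx0|nv]; last by have [] := bX v vI nv; rewrite vw wA.
by rewrite -vw vx0 cut_adj_source ?orbT.
Qed.

(** If [S] were inside [I], an arrow within [S] and one from its head to [x0] would have witnesses
    [w] and [w1] in [A]. Comparing an opposite [b] with [x0] makes [b] adjacent to all of [S];
    comparing it with [w1] is then contradictory. *)
Lemma cut_not_in_indep : exists y, y \in S :\: I.
Proof.
case: (set_0Vmem (S :\: I)) => [S0|[y]]; last by exists y.
have SI z : z \in S -> z \in I.
  by move=> zS; have := in_set0 z; rewrite -S0 inE zS andbT => /negbFE.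
have [z [z' [w [zS z'S a]]]] : exists z z' w, [/\ z \in S, z' \in S & arrow z w z'].
  case/card_gt1P: cut_gt1 => z [z' [zS z'S nzz']].
  by have [w /orP[a|a]] := arrow_total (SI _ zS) (SI _ z'S) nzz';
    [exists z, z', w | exists z', z, w].
have wS := arrow_inside_cut (SI _ zS) (SI _ z'S) z'S a.
have [_ wadj] := arrow_indep (SI _ zS) (SI _ z'S) a.
have wx0 : e w x0 by apply: wadj => //; apply: contraNneq x0S => ->.
have wA : w \in A by case: A_side => _ _ cl _; apply: (cl x0); rewrite 1?e_sym.
have nwx0 : w != x0 by apply: contraTneq wx0 => ->; rewrite e_irr.
have [w1 w1S a1] := arrow_to_source (SI _ z'S) z'S.
have nw1x0 : w1 != x0.
  by apply: contraTneq (arrow_edge a1) => ->; rewrite (I_indep (SI _ z'S) x0I).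
have w1A : w1 \in A.
  apply: contraFT (arrow_missr a) => w1A; rewrite e_sym.
  case/arrowP: a1 => _ _ _ _ /(_ w nwx0); rewrite /dominates2.
  case/or4P=> [/eqP wz'|/eqP ww1|//|].
  - by rewrite wz' z'S in wS.
  - by rewrite -ww1 wA in w1A.
  - by rewrite (side_farC A_side).
have [_ _ _ [b bA bS]] := A_side.
have bSadj y : y \in S -> e b y.
  move=> yS.
  have [D|[v c]|[v c]] :=
    critical_nonadjacent (memA_neq x0A bA) (side_far A_side x0A bA bS).
  - have := D w1; rewrite /dominates2 (negPf nw1x0) (negPf (memA_neq w1A bA)).
    by rewrite (e_sym x0) (arrow_missr a1) (side_farC A_side w1A).
  - have vS := arrow_in_cut x0S c.
    by have := arrow_edge c; rewrite (I_indep x0I (SI _ vS)).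
  - have vS := arrow_in_cut bS c.
    case: (eqVneq y v) => [->|nyv]; first exact: arrow_edge c.
    case/arrowP: c => _ _ _ _ /(_ y); rewrite /dominates2 (negPf nyv).
    rewrite (I_indep (SI _ vS) (SI _ yS)) orbF /= => /(_ _)/orP[|/eqP yb|//].
      by apply: contraNneq x0S => <-.
    by rewrite -yb yS in bS.
have [D|[v c]|[v c]] :=
  critical_nonadjacent (memA_neq w1A bA) (side_far A_side w1A bA bS).
- have := D x0; rewrite /dominates2 (arrow_missr a1) (side_farC A_side x0A) //.
  by rewrite eq_sym (negPf nw1x0) (negPf (memA_neq x0A bA)).
- have vS := arrow_in_cut (AS w1A) c.
  by have := arrow_missr c; rewrite e_sym bSadj.
- have vS := arrow_in_cut bS c.
  case/arrowP: c => _ _ _ _ /(_ x0); rewrite eq_sym nw1x0 => /(_ isT).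
  rewrite /dominates2 (negPf (memA_neq x0A bA)) (side_farC A_side x0A) //=.
  by rewrite (I_indep (SI _ vS) x0I) // orbF => /eqP xv; move: x0S; rewrite xv vS.
Qed.

(** If [w] were in [A], its adjacencies would pull all of [I :\: S] into [A]. Then [S] is completely
    adjacent to any opposite [b], and the pair [x0], [b] fails at another vertex [x1] of
    [I :\: S]. *)
Lemma witness_opposite z w : z \in I -> z \in S -> arrow z w x0 -> w \notin A.
Proof.
move=> zI zS a; apply/negP=> wA; have [y yY] := cut_not_in_indep.
have [_ wadj] := arrow_indep zI x0I a.
have XA v : v \in I -> v \notin S -> v \in A.
  move=> vI vS; case: (eqVneq v x0) => [->|nv] //.
  by case: A_side => _ _ cl _; apply: cl (wadj v vI nv) vS.
have [x1 [x1I x1S nx1 _]] := source_arrow yY; have x1A := XA _ x1I x1S.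
have [_ _ _ [b bA bS]] := A_side.
have bSadj y' : y' \in S -> e y' b.
  move=> y'S; case: (boolP (y' \in I)) => y'I; last first.
    have y'Y : y' \in S :\: I by rewrite inE y'I.
    have [v [vI vS _ c]] := source_arrow y'Y.
    by apply: (cut_dominates_opposite y'Y c) => //; rewrite eq_sym (memA_neq (XA v vI vS)).
  have [w2 w2S c] := arrow_to_source y'I y'S.
  have [_ w2adj] := arrow_indep y'I x0I c.
  have w2A : w2 \in A.
    by case: A_side => _ _ cl _; apply: (cl x1) => //; rewrite e_sym w2adj.
  case/arrowP: c => _ _ _ _ /(_ b); rewrite eq_sym (memA_neq x0A bA) => /(_ isT).
  rewrite /dominates2 (side_far A_side w2A) // eq_sym.
  rewrite [b == w2]eq_sym (negPf (memA_neq w2A bA)) orbF.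
  by case/orP=> // /eqP y'b; rewrite -y'b y'S in bS.
have [D|[v c]|[v c]] :=
  critical_nonadjacent (memA_neq x0A bA) (side_far A_side x0A bA bS).
- have := D x1; rewrite /dominates2 (negPf nx1) (negPf (memA_neq x1A bA)).
  by rewrite I_indep // (side_farC A_side x1A).
- by have := arrow_missr c; rewrite bSadj ?(arrow_in_cut x0S c).
- have vS := arrow_in_cut bS c.
  have vI : v \in I.
    apply: contraFT (arrow_missr c) => vI; apply: cut_adj_source.
    by rewrite inE vI.
  have nx1v : x1 != v by apply: contraNneq x1S => ->.
  have := arrow_dominates c nx1 (memA_neq x1A bA) nx1v (side_farC A_side x1A bA bS).
  by rewrite I_indep.
Qed.

(** The witness [w] forces all of [I :\: S] except [x0] to the opposite side. With two elements in
    [S :\: I] there would be an arrow between two such vertices; its witness [y] dominates [A], and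
    the edge yw dominates G. *)
Lemma card_cut_outside : #|S :\: I| = 1.
Proof.
have [z zI zS] := source_cut_meets_indep.
have [w wS a] := arrow_to_source zI zS; have wA := witness_opposite zI zS a.
have [wI wadj] := arrow_indep zI x0I a.
have XA v : v \in I -> v \notin S -> v != x0 -> v \notin A.
  move=> vI vS nv; apply: contraTN (wadj v vI nv) => vA.
  by rewrite (side_farC A_side).
apply/eqP; rewrite eqn_leq andbC; apply/andP; split.
  by have [y yY] := cut_not_in_indep; apply/card_gt0P; exists y.
rewrite -g_im card_in_imset // leqNgt; apply/negP=> /card_gt1P[u [v [uX vX nuv]]].
have {u v uX vX nuv} [u [y [v [uX vX c]]]] : exists u y v,
    [/\ u \in I :\: S :\ x0, v \in I :\: S :\ x0 & arrow u y v].
  have [/setD1P[nu /setDP[uI uS]] /setD1P[nv /setDP[vI vS]]] := (uX, vX).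
  by have [y /orP[c|c]] := arrow_total uI vI nuv; [exists u, y, v | exists v, y, u].
have [/setD1P[nu uIS] /setD1P[nv /setDP[vI vS]]] := (uX, vX).
have yY := arrow_from_outside uIS vI c; have /setDP[uI uS] := uIS.
have uA := XA u uI uS nu; have vA := XA v vI vS nv.
have [t [tI tS nt d]] := source_arrow yY.
case: (@not_CDS y w); first by right; apply: cut_adj_opposite.
move=> s; rewrite /dominates2; case: (boolP (s \in S)) => sS.
  case: (boolP (s \in I)) => sI.
    by rewrite wadj ?orbT //; apply: contraNneq x0S => <-.
  by rewrite (e_sym w) (@cut_adj_opposite s) ?orbT // inE sI.
case: (boolP (s \in A)) => sA; last first.
  case: (eqVneq s t) => [->|nst]; first by rewrite wadj ?orbT.
  by rewrite (cut_dominates_opposite yY d) ?orbT.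
rewrite (arrow_dominates c) ?orbT //.
- exact: memA_neq sA vA.
- exact: memA_neq sA uA.
- by apply: contraNneq sS => ->; case/setDP: yY.
- exact: (side_farC A_side).
Qed.

(** * Recovering the adjacencies of the class *)

Lemma source_in_G2_33 : in_G2_33 e.
Proof.
have [z zI zS] := source_cut_meets_indep.
have [w wS zw] := arrow_to_source zI zS; have wA := witness_opposite zI zS zw.
have [wI wadj] := arrow_indep zI x0I zw.
have /eqP/cards1P[y SIE] := card_cut_outside.
have yY : y \in S :\: I by rewrite SIE inE.
have /setDP[yS yI] := yY; have [x1 [x1I x1S nx1x0 x0y]] := source_arrow yY.
have wx1 : e w x1 := wadj _ x1I nx1x0.
have x1A : x1 \notin A by apply: contraTN wx1 => x1A; rewrite (side_farC A_side).
have inS s : (s \in S) = (s == z) || (s == y).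
  apply/idP/orP=> [sS|[]/eqP-> //]; case: (boolP (s \in I)) => sI; last first.
    by right; rewrite -in_set1 -SIE inE sI.
  (* A second vertex of [I] in [S] would give, by its arrow to or from [z], a vertex outside [S]
     adjacent to both [x0] and [x1], which [S] separates. *)
  left; apply: contraT => nsz.
  suff [t [tS tx0 tx1]] : exists t, [/\ t \notin S, e t x0 & e t x1].
    have tA : t \in A by apply: contraTT tx0 => tA; rewrite (side_farC A_side).
    by move: tx1; rewrite (side_far A_side).
  have nS a b : a \in S -> b \notin S -> b != a by move=> aS; apply: contraNneq => ->.
  have [t /orP[a|a]] := arrow_total sI zI nsz; exists t.
    have [_ tadj] := arrow_indep sI zI a.
    by split; [apply: arrow_inside_cut a | apply: tadj; rewrite ?nS..].
  have [_ tadj] := arrow_indep zI sI a.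
  by split; [apply: arrow_inside_cut a | apply: tadj; rewrite ?nS..].
have yz : e y z := cut_adj_indep yY zI zS.
have yx1 : e y x1 = false := arrow_missr x0y.
have yx0 : e y x0 := cut_adj_source yY.
have zx0 : e z x0 = false := I_indep zI x0I.
have zx1 : e z x1 = false := I_indep zI x1I.
have x0x1 : e x0 x1 = false := I_indep x0I x1I.
have nzy : z != y by apply: contraTneq yz => ->; rewrite e_irr.
have [nAz nAy] : (forall a, a \in A -> a != z) /\ (forall a, a \in A -> a != y).
  by split=> a /AS; rewrite inS => /norP[].
have [nx1z nx1y] : x1 != z /\ x1 != y by move: x1S; rewrite inS => /norP[].
have nAx1 a : a \in A -> a != x1 by move=> aA; apply: memA_neq aA x1A.
(* In the notation of [in_G2_33], [A] is [J2], [x0] is [u2], [z] is [w], [y] is [w1] and [x1] is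
   [v1]. The present [w] is just a vertex of [J1], and [u1] will be the vertex [u] of [A] that [y]
   misses. *)
pose J1 : {set T} := [set b | [&& b \notin A, b \notin S & b != x1]].
have J1P b : b \in J1 -> [/\ b \notin A, b \notin S & b != x1].
  by rewrite inE => /and3P.
have Sx1 s : s \in S -> e s x1 = false by rewrite inS => /orP[]/eqP->.
have far_x1 a : a \in A -> e a x1 = false by move=> aA; apply: (side_far A_side).
have step_x1 a v : a \in A -> e a v -> e v x1 = false.
  move=> aA av; case: (boolP (v \in S)) => [/Sx1 //|vS]; apply: far_x1.
  by apply: contraTT av => vA; rewrite (side_far A_side).
(* Neither a vertex of [A] nor any of its neighbours is adjacent to [x1], so an arrow with tail in
   [A] can only have head [x1]. *)
have arrow_x1 a v t : a \in A -> t != x1 -> arrow a v t = false.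
  move=> aA ntx1; apply/negP=> a_; have av := arrow_edge a_.
  have nx1a : x1 != a by rewrite eq_sym nAx1.
  have nx1v : x1 != v by apply: contraTneq av => <-; rewrite far_x1.
  have := arrow_dominates a_ _ nx1a nx1v (far_x1 a aA).
  by rewrite (step_x1 a) // eq_sym => /(_ ntx1).
have zA a : a \in A -> a != x0 -> e z a.
  move=> aA nax0; case/arrowP: zw => _ _ _ _ /(_ _ nax0); rewrite /dominates2.
  by rewrite (negPf (nAz _ aA)) (negPf (memA_neq aA wA)) (side_farC A_side aA wA wS) orbF.
have yB b : b \in J1 -> e y b.
  by case/J1P=> bA bS nb; apply: (cut_dominates_opposite yY x0y).
have bx1 b : b \in J1 -> e b x1.
  move=> bJ; have [bA bS nbx1] := J1P b bJ.
  have nx1b : x1 != b by rewrite eq_sym.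
  have [D|[v c]|[v c]] :=
    critical_nonadjacent (memA_neq x0A bA) (side_far A_side x0A bA bS).
  - by have := D x1; rewrite /dominates2 (negPf nx1x0) x0x1 (negPf nx1b).
  - by rewrite arrow_x1 in c.
  - have vS := arrow_in_cut bS c; move: (vS); rewrite inS.
    case/orP=> /eqP vE; rewrite {v}vE in c vS; last by have := arrow_missr c; rewrite yx0.
    case/arrowP: c => _ _ _ _ /(_ x1 nx1x0); rewrite /dominates2.
    by rewrite (negPf nx1b) (negPf nx1z) zx1 orbF.
(* If [y] is adjacent to [a], no arrow joins [a] and [b]; they dominate G, and each covers its own
   side. *)
have pairAB a b : a \in A -> a != x0 -> b \in J1 ->
    ((forall a', a' \in A -> a' != a -> e a a') /\
     (forall b', b' \in J1 -> b' != b -> e b b')) \/ e y a = false.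
  move=> aA nax0 bJ; have [bA bS nbx1] := J1P b bJ.
  have [D|[v c]|[v c]] :=
    critical_nonadjacent (memA_neq aA bA) (side_far A_side aA bA bS).
  - left; split=> [a' a'A na'|b' b'J nb'].
      have := D a'; rewrite /dominates2 (negPf na') (negPf (memA_neq a'A bA)).
      by rewrite (side_farC A_side a'A bA bS) orbF.
    have [b'A b'S _] := J1P b' b'J; have := D b'.
    rewrite /dominates2 (negPf nb') (side_far A_side aA b'A b'S) eq_sym.
    by rewrite (negPf (memA_neq aA b'A)).
  - by rewrite arrow_x1 in c.
  - have := arrow_in_cut bS c; rewrite inS => /orP[]/eqP vE; rewrite {v}vE in c.
      by have := arrow_missr c; rewrite zA.
    by right; apply: arrow_missr c.
have wJ : w \in J1.
  by rewrite inE wA wS; apply: contraTneq wx1 => ->; rewrite e_irr.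
(* If [y] were adjacent to all of [A], the edge yw would dominate G. *)
have [u uA yu] : exists2 u, u \in A & e y u = false.
  case: (pickP [pred u in A | ~~ e y u]) => [u /andP[uA /negPf yu]|no]; first by exists u.
  case: (@not_CDS y w); first by right; apply: yB.
  move=> t; rewrite /dominates2; case: (eqVneq t y) => //= nty.
  case: (eqVneq t z) => [->|ntz]; first by rewrite yz orbT.
  case: (eqVneq t x1) => [->|ntx1]; first by rewrite wx1 !orbT.
  case: (boolP (t \in A)) => tA.
    by have := no t; rewrite /= tA => /negbFE->; rewrite orbT.
  by rewrite yB ?orbT // inE tA ntx1 inS negb_or ntz nty.
have nux0 : u != x0 by apply: contraFneq yu => ->.
(* With a second missed vertex [a], an arrow from [y] to [u] would need a witness adjacent to both
   [a] and [x1]. *)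
have yA a : a \in A -> a != u -> e y a.
  move=> aA nau; apply: contraT => /negPf nya.
  have uy : e u y = false by rewrite e_sym.
  have [D|[v c]|[v c]] := critical_nonadjacent (nAy _ uA) uy.
  - have := D x1; rewrite /dominates2 far_x1 // yx1 eq_sym (negPf (nAx1 _ uA)).
    by rewrite (negPf nx1y).
  - by rewrite arrow_x1 // eq_sym in c.
  - have nx1v : x1 != v by apply: contraTneq (arrow_edge c) => <-; rewrite yx1.
    have nx1u : x1 != u by rewrite eq_sym nAx1.
    have vx1 := arrow_dominates c nx1u nx1y nx1v yx1.
    have nav : a != v by apply: contraTneq (arrow_edge c) => <-; rewrite nya.
    have va := arrow_dominates c nau (nAy _ aA) nav nya.
    by rewrite (step_x1 a) // e_sym in vx1.
(* All neighbours of [x1] lie in [J1], and degrees are at least 3. *)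
have J1_gt2 : 2 < #|J1|.
  apply: leq_ltn_trans cut_gt1 (leq_trans (S_degree x1) (subset_leq_card _)).
  apply/subsetP=> b; rewrite !inE e_sym => bx; apply/and3P; split.
  - by apply: contraTN bx => /far_x1->.
  - by apply: contraTN bx => /Sx1->.
  - by apply: contraTneq bx => ->; rewrite e_irr.
(* Among its at least three neighbours, [x0] has only [y] outside [A]. *)
have cAx0 : 1 < #|A :\ x0|.
  have := leq_ltn_trans cut_gt1 (S_degree x0); rewrite /degree.
  rewrite (cardsD1 y) inE (e_sym x0) yx0 add1n ltnS => /leq_trans-> //.
  apply/subset_leq_card/subsetP=> a; rewrite !inE => /andP[nay x0a].
  rewrite (contraTneq _ x0a) => [|->]; last by rewrite e_irr.
  case: A_side => _ _ cl _; apply: (cl x0) => //; rewrite inS (negPf nay) orbF.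
  by apply: contraTneq x0a => ->; rewrite e_sym zx0.
(* Being adjacent to [y], the vertex [a0] makes [pairAB] yield the clique on [J1]. *)
have [a0 [a0A na0x0 na0u]] : exists a, [/\ a \in A, a != x0 & a != u].
  have: 0 < #|A :\ x0 :\ u| by move: cAx0; rewrite (cardsD1 u) !inE nux0 uA.
  by case/card_gt0P=> a; rewrite !inE => /and3P[]; exists a.
have J1_clique b b' : b \in J1 -> b' \in J1 -> b' != b -> e b b'.
  move=> bJ b'J nb; have [[_]|] := pairAB a0 b a0A na0x0 bJ; first exact.
  by rewrite yA.
have A_univ a a' : a \in A -> a' \in A -> a != x0 -> a != u -> a' != a -> e a a'.
  move=> aA a'A nax0 nau na; have [[+ _]|] := pairAB a w aA nax0 wJ; first exact.
  by rewrite yA.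
(* A non-adjacent pair inside [A] cannot dominate [x1], and no arrow from [A] ends in [A]. *)
have x0u : e x0 u.
  apply: contraT => /negPf x0u; have nx0u : x0 != u by rewrite eq_sym.
  have [D|[v c]|[v c]] := critical_nonadjacent nx0u x0u.
  - have := D x1; rewrite /dominates2 !far_x1 // !(eq_sym x1).
    by rewrite !(negPf (nAx1 _ _)).
  - by rewrite arrow_x1 // nAx1 in c.
  - by rewrite arrow_x1 // nAx1 in c.
have A_clique a a' : a \in A -> a' \in A -> a' != a -> e a a'.
  move=> aA a'A na; have na' : a != a' by rewrite eq_sym.
  case: (boolP ((a != x0) && (a != u))) => [/andP[nax0 nau]|]; first exact: A_univ.
  case: (boolP ((a' != x0) && (a' != u))) => [/andP[nax0 nau] _|].
    by rewrite e_sym A_univ.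
  rewrite !negb_and !negbK => /orP[]/eqP a'E /orP[]/eqP aE;
    by move: na; rewrite aE a'E ?eqxx ?x0u // e_sym x0u.
(* An arrow from [z] to [b] would need a witness adjacent to both [x0] and [x1]; the reverse arrow
   would have witness [y], which is adjacent to [z]. *)
have zB b : b \in J1 -> e z b.
  move=> bJ; have [bA bS nbx1] := J1P b bJ; apply: contraT => /negPf zb.
  have nbz : b != z by apply: contraNneq bS => ->.
  have bz : e b z = false by rewrite e_sym.
  have bx0 : e b x0 = false := side_farC A_side x0A bA bS.
  have [D|[v c]|[v c]] := critical_nonadjacent nbz bz.
  - have := D x0; rewrite /dominates2 (negPf (memA_neq x0A bA)) (negPf (nAz _ x0A)).
    by rewrite bx0 zx0.
  - have := arrow_in_cut bS c; rewrite inS => /orP[]/eqP vE; rewrite {v}vE in c.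
      by have := arrow_edge c; rewrite bz.
    by have := arrow_missr c; rewrite yz.
  - have nx0v : x0 != v by apply: contraTneq (arrow_edge c) => <-; rewrite zx0.
    have nx1v : x1 != v by apply: contraTneq (arrow_edge c) => <-; rewrite zx1.
    have nx1b : x1 != b by rewrite eq_sym.
    have vx0 := arrow_dominates c (memA_neq x0A bA) (nAz _ x0A) nx0v zx0.
    have := arrow_dominates c nx1b nx1z nx1v zx1.
    by rewrite (step_x1 x0) // e_sym.
(* These rewriting tuples decide every membership and equality test for each class of vertices, so
   that [G] can be evaluated class by class. *)
have J1C b : b \in J1 -> ((b \in J1 = true) * (b \in A = false) * (b == z = false)
    * (b == y = false) * (b == x1 = false))%type.
  move=> bJ; have [bA bS nb] := J1P b bJ; move: bS; rewrite inS => /norP[nbz nby].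
  by rewrite bJ (negPf bA) (negPf nbz) (negPf nby) (negPf nb).
have AC r : r \in A -> ((r \in A = true) * (r \in J1 = false) * (r == z = false)
    * (r == y = false) * (r == x1 = false))%type.
  move=> rA; rewrite rA (negPf (nAz _ rA)) (negPf (nAy _ rA)) (negPf (nAx1 _ rA)).
  by do !split=> //; apply: contraTF rA => /J1P[].
have zC : ((z \in J1 = false) * (z \in A = false)
    * (z == y = false) * (z == x1 = false))%type.
  rewrite (negPf nzy) eq_sym (negPf nx1z); do !split=> //.
    by apply: contraTF zS => /J1P[].
  by apply: contraTF zS => /AS.
have yC : ((y \in J1 = false) * (y \in A = false)
    * (y == z = false) * (y == x1 = false))%type.
  rewrite !(eq_sym y) (negPf nzy) (negPf nx1y); do !split=> //.
    by apply: contraTF yS => /J1P[].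
  by apply: contraTF yS => /AS.
have x1C : ((x1 \in J1 = false) * (x1 \in A = false)
    * (x1 == z = false) * (x1 == y = false))%type.
  rewrite (negPf x1A) (negPf nx1z) (negPf nx1y); do !split=> //.
  by rewrite inE eqxx !andbF.
have class t : [\/ t \in J1, t \in A, t = z | t = y \/ t = x1].
  case: (boolP (t \in A)) => [|tA]; first by constructor 2.
  case: (eqVneq t z) => [|ntz]; first by constructor 3.
  case: (eqVneq t y) => [|nty]; first by constructor 4; left.
  case: (eqVneq t x1) => [|ntx1]; first by constructor 4; right.
  by constructor 1; rewrite inE tA ntx1 inS negb_or ntz nty.
exists J1, A, u, x0, z, y, x1; split.
- by split=> //; rewrite (cardsD1 x0) x0A.
- split; rewrite -setI_eq0; apply/eqP/setP=> t; rewrite !in_setI in_set0.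
    by apply/negP=> /andP[/J1C->].
  apply/negP=> /andP[tJA]; rewrite !inE -orbA.
  by case/or3P=> /eqP tE; move: tJA; rewrite tE in_setU ?zC ?yC ?x1C.
- split; first by rewrite /= !inE negb_or !zC !yC.
  apply/setP=> t; rewrite !in_setU !in_set1 in_setT.
  by case: (class t) => [->|->|->|[->|->]]; rewrite ?eqxx ?orbT.
- by split.
pose G := G2_arc J1 A u x0 z y x1.
move=> s t; rewrite -/(G s t) -/(G t s).
have GC a b : e a b = G a b || G b a -> e b a = G b a || G a b.
  by rewrite e_sym orbC.
have GE a b : G a b = [|| [&& a \in J1, b \in J1 & a != b],
    [&& a \in A, b \in A & a != b], (a == x1) && (b \in J1),
    (a == y) && [|| b \in J1, (b != u) && (b \in A) | b == z]
  | (a == z) && [|| b \in J1, (b != x0) && (b \in A) | b == y]].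
  by rewrite /G /G2_arc /= !in_setU !in_setD1 !in_set1 -!orbA.
have GJJ a b : a \in J1 -> b \in J1 -> e a b = G a b || G b a.
  move=> aJ bJ; rewrite !GE !(J1C _ aJ) !(J1C _ bJ) /= (eq_sym b) !orbF orbb.
  case: eqVneq => [->|nab]; first by rewrite e_irr.
  by rewrite J1_clique // eq_sym.
have GAA a b : a \in A -> b \in A -> e a b = G a b || G b a.
  move=> aA bA; rewrite !GE !(AC _ aA) !(AC _ bA) /= (eq_sym b) !orbF orbb.
  case: eqVneq => [->|nab]; first by rewrite e_irr.
  by rewrite A_clique // eq_sym.
have GJA b a : b \in J1 -> a \in A -> e b a = G b a || G a b.
  move=> bJ aA; rewrite !GE !(AC _ aA) !(J1C _ bJ) /=.
  by have [bA bS _] := J1P b bJ; rewrite (side_farC A_side).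
have GzA a : a \in A -> e z a = G z a || G a z.
  move=> aA; rewrite !GE !(AC _ aA) !zC eqxx /= !andbT !orbF.
  by case: eqVneq => [->//|nax0]; rewrite zA.
have GyA a : a \in A -> e y a = G y a || G a y.
  move=> aA; rewrite !GE !(AC _ aA) !yC eqxx /= !andbT !orbF.
  by case: eqVneq => [->//|nau]; rewrite yA.
have Gx1A a : a \in A -> e x1 a = G x1 a || G a x1.
  by move=> aA; rewrite !GE !(AC _ aA) !x1C eqxx /= e_sym far_x1.
have GzJ b : b \in J1 -> e z b = G z b || G b z.
  by move=> bJ; rewrite !GE !(J1C _ bJ) !zC eqxx /= zB.
have GyJ b : b \in J1 -> e y b = G y b || G b y.
  by move=> bJ; rewrite !GE !(J1C _ bJ) !yC eqxx /= yB.
have Gx1J b : b \in J1 -> e x1 b = G x1 b || G b x1.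
  by move=> bJ; rewrite !GE !(J1C _ bJ) !x1C eqxx /= e_sym bx1.
have Gyz : e y z = G y z || G z y by rewrite !GE !(zC, yC, eqxx, andbF, orbT) yz.
have Gyx1 : e y x1 = G y x1 || G x1 y by rewrite !GE !(x1C, yC, eqxx, andbF) yx1.
have Gzx1 : e z x1 = G z x1 || G x1 z by rewrite !GE !(x1C, zC, eqxx, andbF) zx1.
have Gss a : a \in [:: z; y; x1] -> e a a = G a a || G a a.
  rewrite e_irr orbb !inE => /or3P[]/eqP->; rewrite !GE.
  - by rewrite !(zC, eqxx, andbF).
  - by rewrite !(yC, eqxx, andbF).
  - by rewrite !(x1C, eqxx, andbF).
have [Gzz Gyy Gx1x1] : [/\ e z z = G z z || G z z,
    e y y = G y y || G y y & e x1 x1 = G x1 x1 || G x1 x1].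
  by split; apply: Gss; rewrite !inE eqxx ?orbT.
by case: (class s) => [sJ|sA|->|[->|->]]; case: (class t) => [tJ|tA|->|[->|->]];
  auto; apply: GC; auto.
Qed.

End Source.

Lemma indep_gt_cut_in_G2_33 : in_G2_33 e.
Proof.
have [x0 [g [x0_in g_inj g_im g_arrow]]] := source_exists.
have /setDP[_ /side_exists[A sA]] := x0_in.
exact: source_in_G2_33 x0_in g_inj g_im g_arrow sA.
Qed.

End Independent.
End Cut.
End Critical.

(** * Connectivity against minimum degree, and the conclusion *)

Lemma degree_lt_card (T : finType) (e : rel T) (x : T) :
  irreflexive e -> degree e x < #|T|.
Proof.
move=> e_irr; rewrite /degree -cardsT [X in _ < X](cardsD1 x) inE add1n ltnS.
apply/subset_leq_card/subsetP=> y; rewrite !inE andbT.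
by apply: contraTneq => ->; rewrite e_irr.
Qed.

Lemma delta_le_degree (T : finType) (e : rel T) (x : T) : delta e <= degree e x.
Proof. exact: bigminn_le. Qed.

(** The neighbourhood of a vertex [x] of minimum degree is a cut, unless [x] is adjacent to all
    others; then its degree is at least the default [#|T|.-1] that bounds [kappa]. *)
Lemma kappa_le_delta (T : finType) (e : rel T) :
  irreflexive e -> kappa e <= delta e.
Proof.
move=> e_irr; have kT : kappa e <= #|T|.-1 := bigminn_le_default _ _ _.
have [dE|[x _ dE]] := bigminn_witness xpredT (degree e) #|T|; rewrite /delta dE {dE}.
  exact: leq_trans kT (leq_pred _).
case: (pickP [pred y | (y != x) && ~~ e x y]) => [y /andP[nyx nexy]|full].
  apply: (@bigminn_le _ (vertex_cut e) (fun S => #|S|) _ [set y | e x y]).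
  apply/negP=> /forallP/(_ x)/implyP; rewrite !inE e_irr => /(_ isT).
  move=> /forallP/(_ y)/implyP; rewrite !inE nexy => /(_ isT)/connectP[[|z p]] /=.
    by move=> _ yx; rewrite yx eqxx in nyx.
  by case/andP=> /and3P[_ + xz]; rewrite !inE xz.
apply: leq_trans kT _; rewrite -cardsT (cardsD1 x) inE add1n.
apply/subset_leq_card/subsetP=> y; rewrite !inE andbT => nyx.
by have := full y; rewrite /= nyx => /negbFE.
Qed.

Theorem theorem3p7 (T : finType) (e : rel T)
    (e_sym : symmetric e) (e_irr : irreflexive e)
    (e_conn : connected_graph e)
    (e_crit : critical3 e)
    (kappa_alpha : kappa e + 1 <= alpha e) :
  in_G2_33 e \/ kappa e = delta e.
Proof.
have := kappa_le_delta e_irr; rewrite leq_eqVlt => /predU1P[|lt_kd]; first by right.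
(* The default is excluded: [kappa] is below some degree, and degrees are at most [#|T|.-1]. *)
left; have [S S_cut cS] : exists2 S, vertex_cut e S & kappa e = #|S|.
  have [kT|//] := bigminn_witness (vertex_cut e) (fun S => #|S|) #|T|.-1.
  have /andP[/card_gt0P[x _] _] := e_conn.
  have := leq_trans lt_kd (delta_le_degree e x); rewrite /kappa kT.
  by have := degree_lt_card x e_irr; case: #|T| => //= n; rewrite ltnS leqNgt => /negPf->.
have S_degree x : #|S| < degree e x.
  by rewrite -cS; apply: leq_trans lt_kd (delta_le_degree e x).
have [I I_indep cI] : exists2 I, independent e I & #|S| < #|I|.
  case: (pickP [pred I | independent e I & #|S| < #|I|]) => [I /andP[]|no].
    by exists I.
  suff: alpha e <= #|S| by rewrite leqNgt -cS -addn1 kappa_alpha.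
  by apply/bigmax_leqP=> I iI; have := no I; rewrite /= iI ltnNge => /negbFE.
apply: (indep_gt_cut_in_G2_33 e_sym e_irr e_conn e_crit S_cut S_degree _ cI).
move=> x y xI yI; apply/negbTE.
by move: I_indep => /forallP/(_ x)/implyP/(_ xI)/forallP/(_ y)/implyP/(_ yI).
Qed.
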